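(* Let $W$ be a non-empty set and $R\subseteq W\times W$ a reflexive and symmetric relation. On the power set algebra $\mathcal{P}(W)$ define, for $A,B\subseteq W$, $$A\mathrel{\mathsf{C}_R}B \iff (\exists x\in A)(\exists y\in B)\; x\mathrel{R}y .$$ Then $\langle \mathcal{P}(W),\mathsf{C}_R\rangle$ is a complete Boolean contact algebra satisfying (C4$^c$): for all $A\subseteq W$ and all families $J\subseteq\mathcal{P}(W)$, if $A\mathrel{\mathsf{C}_R}\bigvee J$, then there is $B\in J$ with $A\mathrel{\mathsf{C}_R}B$.
   Context: A Boolean contact algebra is a pair $\langle\mathfrak{B},\mathsf{C}\rangle$ where $\mathfrak{B}=\langle B,\cdot,+,-,\mathbf{0},\mathbf{1}\rangle$ is a Boolean algebra and $\mathsf{C}\subseteq B\times B$ satisfies, for all $x,y,z\in B$: (C0) not $\mathbf{0}\mathrel{\mathsf{C}}x$; (C1) if $x\le y$ and $x\ne\mathbf{0}$, then $x\mathrel{\mathsf{C}}y$; (C2) if $x\mathrel{\mathsf{C}}y$, then $y\mathrel{\mathsf{C}}x$; (C3) if $x\le y$ and $z\mathrel{\mathsf{C}}x$, then $z\mathrel{\mathsf{C}}y$; (C4) if $x\mathrel{\mathsf{C}}(y+z)$, then $x\mathrel{\mathsf{C}}y$ or $x\mathrel{\mathsf{C}}z$. It is complete if $\mathfrak{B}$ is a complete Boolean algebra. $\bigvee J$ denotes the supremum of $J$ (in $\mathcal{P}(W)$, the union). The algebras $\langle \mathcal{P}(W),\mathsf{C}_R\rangle$ are called relational contact algebras. *)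

(* Defs.v *)
From HB Require Import structures.
From mathcomp Require Import all_boot all_order.
From mathcomp Require Import boolp classical_sets.

Set Implicit Arguments.
Unset Strict Implicit.
Unset Printing Implicit Defensive.

Local Open Scope classical_set_scope.
Local Open Scope order_scope.

(* Boolean algebras are [ctbDistrLatticeType]s (complemented distributive
   lattices with bottom and top; 0 <> 1 is not required). The power set algebra
   is the instance [set W] provided by classical_sets, whose order is inclusion
   and whose operations are setI, setU, setC, set0 and setT. *)

Record is_contact {d : Order.disp_t} {B : ctbDistrLatticeType d}
    (C : B -> B -> Prop) : Prop := IsContact {
  contact0 : forall x : B, ~ C \bot x;
  contact_le : forall x y : B, x <= y -> x <> \bot -> C x y;
  contact_sym : forall x y : B, C x y -> C y x;
  contact_mono : forall x y z : B, x <= y -> C z x -> C z y;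
  contact_join : forall x y z : B, C x (y `|` z) -> C x y \/ C x z }.

Definition complete_lattice {d : Order.disp_t} (L : latticeType d) : Prop :=
  forall J : set L, (exists s, supremums J s) /\ (exists i, infimums J i).

Definition is_complete_BCA {d : Order.disp_t} (B : ctbDistrLatticeType d)
    (C : B -> B -> Prop) : Prop :=
  complete_lattice B /\ is_contact C.

(* [supremums J s] says that s is the supremum of J: suprema are unique. *)
Definition C4c {d : Order.disp_t} {B : ctbDistrLatticeType d}
    (C : B -> B -> Prop) : Prop :=
  forall (x : B) (J : set B) (s : B),
    supremums J s -> C x s -> exists2 y, J y & C x y.

Definition contact_rel {W : Type} (R : W -> W -> Prop) (A B : set W) : Prop :=
  exists2 x, A x & exists2 y, B y & R x y.

(* Main.v *)
Require Import Defs.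
From mathcomp Require Import all_boot all_order.
From mathcomp Require Import boolp classical_sets.

Local Open Scope classical_set_scope.

(** Contact in [set W] is witnessed by a pair of related points, and a point of a union already lies
    in one of its members. This gives (C4), and (C4$^c$) for arbitrary families. Reflexivity of [R]
    yields (C1) and symmetry yields (C2). Completeness comes from unions and intersections. *)

Lemma supremums_bigcup (W : Type) (J : set (set W)) :
  supremums J (\bigcup_(A in J) A).
Proof.
split=> [A JA|B ubB]; rewrite subsetEset; first exact: bigcup_sup.
by apply: bigcup_sub => A JA; rewrite -subsetEset; exact: ubB.
Qed.

Lemma infimums_bigcap (W : Type) (J : set (set W)) :
  infimums J (\bigcap_(A in J) A).
Proof.
split=> [A JA|B lbB]; rewrite subsetEset; first exact: bigcap_inf.
by apply: sub_bigcap => A JA; rewrite -subsetEset; exact: lbB.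
Qed.

Lemma contact_rel_is_contact (W : Type) (R : W -> W -> Prop)
    (R_refl : forall x : W, R x x) (R_sym : forall x y : W, R x y -> R y x) :
  is_contact (contact_rel R).
Proof.
split.
- by move=> A [].
(* Bottom is the empty set, so [A] has a point [x]; it also lies in [B] and, by [R_refl], serves as
   both witnesses. *)
- move=> A B; rewrite subsetEset => sAB /eqP/set0P[x Ax].
  by exists x => //; exists x => //; exact: sAB.
- by move=> A B [x Ax [y By Rxy]]; exists y => //; exists x => //; exact: R_sym.
- move=> A B D; rewrite subsetEset => sAB [x Dx [y Ay Rxy]].
  by exists x => //; exists y => //; exact: sAB.
- by move=> A B D [x Ax [y [By|Dy] Rxy]]; [left|right]; exists x => //; exists y.
Qed.

Lemma contact_rel_C4c (W : Type) (R : W -> W -> Prop) : C4c (contact_rel R).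
Proof.
move=> A J S [_ lubS] [x Ax [y Sy Rxy]].
(* The union of [J] is an upper bound, so the least one, [S], is included in it; hence [y] lies in
   some member [B]. *)
have := lubS _ (supremums_bigcup W J).1; rewrite subsetEset => /(_ y Sy)[B JB By].
by exists B => //; exists x => //; exists y.
Qed.

Theorem proposition4p2 (W : Type) (W_nonempty : inhabited W)
    (R : W -> W -> Prop) (R_refl : forall x : W, R x x)
    (R_sym : forall x y : W, R x y -> R y x) :
  is_complete_BCA (contact_rel R) /\ C4c (contact_rel R).
Proof.
split; last exact: contact_rel_C4c.
split; last exact: contact_rel_is_contact.
move=> J; split.
- by exists (\bigcup_(A in J) A); exact: supremums_bigcup.
- by exists (\bigcap_(A in J) A); exact: infimums_bigcap.
Qed.
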